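(* Let $q$ be a prime power and let $\mathcal{L}=\langle F,G\rangle$ be a pencil of plane curves of degree $d\le q$ in $\mathbb{P}^2$ defined over $\mathbb{F}_q$ with no $\mathbb{F}_q$-points in its base locus. Then at least $\frac{q+1}{d+1}$ distinct $\mathbb{F}_q$-members of $\mathcal{L}$ are nonblocking curves.
   Context: A pencil of plane curves $\mathcal{L}=\langle F,G\rangle$ of degree $d$ over $\mathbb{F}_q$ is given by two linearly independent homogeneous polynomials $F,G\in\mathbb{F}_q[x,y,z]$ of the same degree $d\ge 1$. Its $\mathbb{F}_q$-members are the $q+1$ plane curves $C_{[s:t]}=\{sF+tG=0\}\subset\mathbb{P}^2$ for $[s:t]\in\mathbb{P}^1(\mathbb{F}_q)$; members are counted by their parameters $[s:t]$. The pencil has no $\mathbb{F}_q$-points in its base locus if there is no $P\in\mathbb{P}^2(\mathbb{F}_q)$ with $F(P)=G(P)=0$. A set $B\subseteq\mathbb{P}^2(\mathbb{F}_q)$ is a blocking set if every $\mathbb{F}_q$-line (line in $\mathbb{P}^2$ defined over $\mathbb{F}_q$) meets $B$, i.e. contains a point of $B$. A plane curve $C$ defined over $\mathbb{F}_q$ is a blocking curve if its set $C(\mathbb{F}_q)$ of $\mathbb{F}_q$-points is a blocking set, and is nonblocking otherwise. *)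

(* Defs.v *)
From HB Require Import structures.
From mathcomp Require Import all_boot all_order all_algebra.
From mathcomp Require Import mpoly.

Set Implicit Arguments.
Unset Strict Implicit.
Unset Printing Implicit Defensive.

Import Order.TTheory GRing.Theory Num.Theory.
Local Open Scope ring_scope.

(* A point of P^n(K) is the class [v_0 : ... : v_n] of a nonzero vector v under
   scaling by K^*, encoded as the finite set of its coordinate vectors. *)
Definition proj_point (K : finFieldType) (n : nat) (v : 'rV[K]_n.+1) :
    {set 'rV[K]_n.+1} :=
  [set a *: v | a : K & a != 0].

Definition proj_space (K : finFieldType) (n : nat) : {set {set 'rV[K]_n.+1}} :=
  [set proj_point v | v : 'rV[K]_n.+1 & v != 0].

(* For homogeneous f, vanishing does not depend on the coordinate vector, so
   quantifying over all v \in P is the same as picking one. *)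
Definition rational_points (K : finFieldType) (n : nat)
    (f : {mpoly K[n.+1]}) : {set {set 'rV[K]_n.+1}} :=
  [set P in proj_space K n | [forall v in P, f.@[v 0] == 0]].

Definition plane_line (K : finFieldType) (a : 'rV[K]_3) :
    {set {set 'rV[K]_3}} :=
  rational_points (\sum_(i < 3) a 0 i *: 'X_i).

Definition blocking_set (K : finFieldType) (B : {set {set 'rV[K]_3}}) : bool :=
  [forall (a : 'rV[K]_3 | a != 0), plane_line a :&: B != set0].

Definition blocking_curve (K : finFieldType) (f : {mpoly K[3]}) : bool :=
  blocking_set (rational_points f).

Definition lin_indep (K : finFieldType) (F G : {mpoly K[3]}) : Prop :=
  forall s t : K, s *: F + t *: G = 0 -> s = 0 /\ t = 0.

Definition pencil_member (K : finFieldType) (F G : {mpoly K[3]})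
    (u : 'rV[K]_2) : {mpoly K[3]} :=
  u 0 0 *: F + u 0 1 *: G.

(* Members are counted by their parameter [s : t] in P^1(K); rescaling (s, t)
   rescales the equation s F + t G and so does not change the curve. *)
Definition nonblocking_members (K : finFieldType) (F G : {mpoly K[3]}) :
    {set {set 'rV[K]_2}} :=
  [set m in proj_space K 1 |
    [forall u in m, ~~ blocking_curve (pencil_member F G u)]].

(* Main.v *)
(* Colour each rational point by the unique member of the pencil through it.
   The q^2 + q + 1 points carry q + 1 colours, so convexity gives at least
   q^3 + q ordered pairs of distinct points of the same colour; each lies on one
   of the q^2 + q + 1 lines, so some line l carries at least q such pairs.
   With x_m the number of points of l on the member m, this says
   sum_m x_m (x_m - 1) >= q. The number N of members missing l is
   sum_m max(x_m - 1, 0), because sum_m x_m = q + 1 is also the number of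
   members. Either all x_m <= d, or l lies on one member and N = q; in both
   cases d N >= q, whence (d + 1) N >= q + 1. *)
Require Import Defs.
From mathcomp Require Import all_boot all_order all_algebra mxabelem.
From mathcomp Require Import zify.
From mathcomp Require Import mpoly.
Import Order.TTheory GRing.Theory Num.Theory.
Local Open Scope ring_scope.

Set Implicit Arguments.
Unset Strict Implicit.
Unset Printing Implicit Defensive.

(** * Counting pairs of points of equal colour *)

Section MonochromaticPairs.

Variables (T C : finType) (phi : T -> C) (Cols : {set C}).
Implicit Types X : {set T}.

Definition color_class X c := [set P in X | phi P == c].

Definition mono_pairs X := [set p : T * T |
  [&& p.1 \in X, p.2 \in X, p.1 != p.2 & phi p.1 == phi p.2]].

Lemma sum_card_color_class X : {in X, forall P, phi P \in Cols} ->
  (\sum_(c in Cols) #|color_class X c| = #|X|)%N.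
Proof.
move=> hX; rewrite -[RHS]sum1_card (partition_big phi (mem Cols)) //=.
by apply: eq_bigr => c _; rewrite -sum1_card; apply: eq_bigl => P; rewrite !inE.
Qed.

Lemma card_mono_pairs X : {in X, forall P, phi P \in Cols} ->
  (#|mono_pairs X| =
   \sum_(c in Cols) #|color_class X c| * #|color_class X c|.-1)%N.
Proof.
move=> hX; rewrite -sum1_card.
rewrite (partition_big (fun p => phi p.1) (mem Cols)) /=; last first.
  by move=> p; rewrite inE => /and4P[/hX].
apply: eq_bigr => c _.
transitivity (\sum_(P in color_class X c) \sum_(Q in color_class X c :\ P) 1)%N.
  rewrite pair_big_dep /=; apply: eq_bigl => -[P Q] /=.
  rewrite !inE /= (eq_sym Q) -!andbA.
  case: (P \in X); case: (Q \in X); case: (P != Q) => //=; rewrite ?andbF //.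
  by apply/andP/andP=> -[/eqP-> /eqP->].
rewrite -sum_nat_const; apply: eq_bigr => P hP.
by rewrite sum1_card (cardsD1 P (color_class X c)) hP.
Qed.

(** Every natural [x] satisfies x + [x = 0] = 1 + [x.-1]; sum this over the class sizes and cancel
    [#|X|] against [#|Cols|]. *)
Lemma card_missed_colors X : {in X, forall P, phi P \in Cols} ->
    #|X| = #|Cols| ->
  (#|[set c in Cols | color_class X c == set0]| =
   \sum_(c in Cols) #|color_class X c|.-1)%N.
Proof.
move=> hX eqXC.
suff: (#|X| + #|[set c in Cols | color_class X c == set0]| =
       #|Cols| + \sum_(c in Cols) #|color_class X c|.-1)%N by lia.
rewrite -(sum_card_color_class hX) -!sum1_card.
under [X in (_ + X)%N]eq_bigl do rewrite inE.
rewrite big_mkcondr /= -!big_split /=; apply: eq_bigr => c _.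
by rewrite -cards_eq0; case: (#|color_class X c|%N) => [|k] /=; rewrite ?addn0.
Qed.

End MonochromaticPairs.

Lemma exists_line_many_mono_pairs (T C L : finType) (phi : T -> C)
    (Cols : {set C}) (Pts : {set T}) (Lns : {set L}) (pts : L -> {set T})
    (q : nat) :
    (0 < q)%N -> #|Cols| = q.+1 -> #|Pts| = (q ^ 2 + q + 1)%N ->
    (#|Lns| = q ^ 2 + q + 1)%N ->
    {in Pts, forall P, phi P \in Cols} ->
    {in Pts &, forall P Q, P != Q ->
      exists2 l, l \in Lns & (P \in pts l) && (Q \in pts l)} ->
  exists2 l, l \in Lns & (q <= #|mono_pairs phi (pts l)|)%N.
Proof.
move=> q_gt0 cC cP cL hphi hjoin; apply/exists_inP/contraT.
rewrite negb_exists_in => /forall_inP few.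
(* Union bound under the contrary assumption that each line carries at most q - 1 pairs. The bound
   equals q^3 - 1. *)
have ub : (#|mono_pairs phi Pts| <= (q ^ 2 + q + 1) * q.-1)%N.
  have sub : mono_pairs phi Pts \subset
      \bigcup_(l in Lns) mono_pairs phi (pts l).
    apply/subsetP=> -[P Q]; rewrite inE /= => /and4P[hP hQ nPQ ePQ].
    have [l lL /andP[Pl Ql]] := hjoin _ _ hP hQ nPQ.
    by apply/bigcupP; exists l => //; rewrite inE /= Pl Ql nPQ.
  apply: leq_trans (subset_leq_card sub) _.
  rewrite -cL -sum_nat_const.
  elim/big_rec2: _ => [|l n A lL le_nA]; first by rewrite cards0.
  apply: leq_trans (leq_card_setU _ _) _; apply: leq_add => //.
  by have := few l lL; rewrite -ltnNge -{1}(prednK q_gt0).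
(* The tangent inequality (n - q)(n - q - 1) >= 0 at the average class size. *)
have tangent n : (2 * q * n <= n * n.-1 + (q ^ 2 + q))%N.
  case: n => [|n] /=; first by rewrite muln0.
  rewrite -mulnn; case: (leqP n q) => [/subnKC<-|/ltnW/subnKC<-].
    by move: (q - n)%N; nia.
  by move: (n - q)%N; nia.
have : (\sum_(c in Cols) 2 * q * #|color_class phi Pts c| <=
    \sum_(c in Cols) (#|color_class phi Pts c| * #|color_class phi Pts c|.-1
      + (q ^ 2 + q)))%N by apply: leq_sum.
(* Summed over the q + 1 colours, the tangent inequality bounds the number of pairs below by 2q(q^2
   + q + 1) - (q + 1)(q^2 + q) = q^3 + q, which exceeds q^3 - 1. *)
rewrite -big_distrr big_split /= (sum_card_color_class hphi).
rewrite -(card_mono_pairs hphi) sum_nat_const cC cP.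
by case: q q_gt0 ub {few cC cP cL tangent} => // r _; rewrite -!mulnn /=; nia.
Qed.

(** * Restricting a homogeneous polynomial to a line *)

Section HomogeneousRestriction.

Variable K : finFieldType.
Implicit Types (p r : {poly K}) (a b : nat) (c : K).

(* Degree at most a, with a^th coefficient c, which may be 0. *)
Definition formal_lead p a c := (size p <= a.+1)%N /\ p`_a = c.

Lemma formal_leadM p r a b c e : formal_lead p a c -> formal_lead r b e ->
  formal_lead (p * r) (a + b) (c * e).
Proof.
move=> [sp <-] [sr <-]; split.
  by apply: leq_trans (size_polyMleq _ _) _; lia.
(* Only the index [a] survives in the convolution: a smaller index pairs with a coefficient of [r]
   beyond [b], a larger one is beyond the degree bound of [p]. *)
rewrite coefM (bigD1 (inord a)) //= inordK; last by lia.
rewrite addKn big1 ?addr0 // => i; rewrite -val_eqE /= inordK; last by lia.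
move=> ne_ia; have [lt_ia|le_ai] := ltnP i a.
  by rewrite [r`__]nth_default ?mulr0 //; apply: leq_trans sr _; lia.
by rewrite [p`__]nth_default ?mul0r //; apply: leq_trans sp _; lia.
Qed.

Lemma formal_leadX p a c k : formal_lead p a c ->
  formal_lead (p ^+ k) (k * a) (c ^+ k).
Proof.
move=> pac; elim: k => [|k IHk].
  by rewrite !expr0; split; rewrite ?size_poly1 ?coef1.
by rewrite !exprS mulSn; apply: formal_leadM.
Qed.

Lemma formal_lead_prod (I : finType) (p : I -> {poly K}) (a : I -> nat)
    (c : I -> K) : (forall i, formal_lead (p i) (a i) (c i)) ->
  formal_lead (\prod_i p i) (\sum_i a i) (\prod_i c i).
Proof.
move=> pac; elim/big_rec3: _ => [|i x y z _]; last exact: formal_leadM.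
by split; rewrite ?size_poly1 ?coef1.
Qed.

Variables (n d : nat) (f : {mpoly K[n]}).
Hypothesis f_homog : f \is d.-homog.

Lemma meval_homogZ c (v : 'rV[K]_n) : f.@[(c *: v) 0] = c ^+ d * f.@[v 0].
Proof.
rewrite !mevalE big_distrr /=; apply: eq_big_seq => m.
move=> /(dhomogP _ _ _ f_homog) /= <-; rewrite mulrCA mdegE -prodrXr -big_split /=; congr (_ * _).
by apply: eq_bigr => i _; rewrite mxE exprMn.
Qed.

(** Along w + t v each monomial becomes a product of [d] linear factors w_i + v_i t, so its
    t^d-coefficient is the monomial evaluated at [v], the point at infinity of this
    parametrization. *)
Lemma homog_restrict_line (v w : 'rV[K]_n) : exists p : {poly K},
  formal_lead p d f.@[v 0] /\ forall t, p.[t] = f.@[(w + t *: v) 0].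
Proof.
exists (\sum_(m <- msupp f) f@_m *: \prod_i ((w 0 i)%:P + v 0 i *: 'X) ^+ m i).
split=> [|t]; last first.
  rewrite horner_sum mevalE; apply: eq_bigr => m _.
  rewrite hornerZ horner_prod; congr (_ * _); apply: eq_bigr => i _.
  by rewrite horner_exp !hornerE !mxE mulrC.
have lead m : m \in msupp f -> formal_lead
    (\prod_i ((w 0 i)%:P + v 0 i *: 'X) ^+ m i) d (\prod_i v 0 i ^+ m i).
  move=> /(dhomogP _ _ _ f_homog) /= <-; rewrite mdegE.
  apply: formal_lead_prod => i; rewrite -{2}[m i]muln1.
  apply: formal_leadX; split.
    apply: leq_trans (size_polyD _ _) _; rewrite geq_max size_polyC.
    rewrite (leq_trans (leq_b1 _)) //=.
    by apply: leq_trans (size_scale_leq _ _) _; rewrite size_polyX.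
  by rewrite coefD coefC coefZ coefX /= mulr1 add0r.
split.
  rewrite big_seq; apply: (leq_trans (size_sum _ _ _)).
  apply/bigmax_leqP_seq => m _ /lead[sm _].
  exact: leq_trans (size_scale_leq _ _) sm.
rewrite coef_sum mevalE; apply: eq_big_seq => m /lead[_ cm].
by rewrite coefZ cm.
Qed.

End HomogeneousRestriction.

(** * Projective points, their coordinates and their number *)

Section ProjectiveSpace.

Variable K : finFieldType.

Section AnyDimension.

Variable n : nat.
Implicit Types (u v w : 'rV[K]_n.+1) (P : {set 'rV[K]_n.+1}).

Lemma proj_pointP v w :
  reflect (exists2 c, c != 0 & w = c *: v) (w \in proj_point v).
Proof. by apply: (iffP imsetP) => -[c c0 ->]; exists c; rewrite ?inE in c0 *. Qed.

Lemma proj_point_refl v : v \in proj_point v.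
Proof. by apply/proj_pointP; exists 1; rewrite ?oner_eq0 ?scale1r. Qed.

Lemma proj_pointZ c v : c != 0 -> proj_point (c *: v) = proj_point v.
Proof.
move=> c0; apply/setP=> w; apply/proj_pointP/proj_pointP => -[b b0 ->].
  by exists (b * c); rewrite ?mulf_neq0 ?scalerA.
by exists (b / c); rewrite ?mulf_neq0 ?invr_eq0 // scalerA divfK.
Qed.

Lemma mem_proj_point v w : w \in proj_point v -> proj_point w = proj_point v.
Proof. by case/proj_pointP => c c0 ->; apply: proj_pointZ. Qed.

Lemma eq_proj_point v w : (proj_point w == proj_point v) = (w \in proj_point v).
Proof.
by apply/eqP/idP => [<-|/mem_proj_point//]; apply: proj_point_refl.
Qed.

Lemma card_proj_point v : v != 0 -> #|proj_point v| = #|K|.-1.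
Proof.
move=> v0; rewrite card_in_imset; first by rewrite cardsE cardC1.
by move=> a b _ _ /eqP; rewrite -subr_eq0 -scalerBl scaler_eq0 (negbTE v0) orbF
  subr_eq0 => /eqP.
Qed.

Lemma proj_spaceP P :
  reflect (exists2 v, v != 0 & P = proj_point v) (P \in proj_space K n).
Proof. by apply: (iffP imsetP) => -[v v0 ->]; exists v; rewrite ?inE in v0 *. Qed.

(** Stability under scaling makes each fibre of [proj_point] on [W] a full orbit of [#|K|.-1]
    vectors. This serves to count both projective spaces and lines. *)
Lemma card_proj_cone (W : {set 'rV[K]_n.+1}) : 0 \notin W ->
    (forall (c : K) v, c != 0 -> v \in W -> c *: v \in W) ->
  (#|[set proj_point v | v in W]| * #|K|.-1 = #|W|)%N.
Proof.
move=> W0 WZ; rewrite -[RHS]sum1_card.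
rewrite (partition_big (@proj_point K n) (mem [set proj_point v | v in W])) /=;
  last by move=> v vW; apply: imset_f.
rewrite -sum_nat_const; apply: eq_bigr => _ /imsetP[v vW ->].
rewrite -(@card_proj_point v) -?sum1_card; last by apply: contraNneq W0 => <-.
apply: eq_bigl => w; rewrite eq_proj_point.
apply/idP/andP => [wv|[]//]; split=> //.
by case/proj_pointP: wv => c c0 ->; apply: WZ.
Qed.

Lemma card_proj_space : (#|proj_space K n| * #|K|.-1 = (#|K| ^ n.+1).-1)%N.
Proof.
rewrite card_proj_cone ?inE ?eqxx //; last first.
  by move=> c v c0; rewrite !inE scaler_eq0 negb_or c0.
by rewrite cardsE cardC1 card_mx mul1n.
Qed.

Lemma mem_rational_points d (f : {mpoly K[n.+1]}) v : f \is d.-homog -> v != 0 ->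
  (proj_point v \in rational_points f) = (f.@[v 0] == 0).
Proof.
move=> fh v0; rewrite inE; apply/andP/eqP => [[_ /forall_inP h]|fv].
  by apply/eqP/h/proj_point_refl.
split; first by apply/proj_spaceP; exists v.
apply/forall_inP=> _ /proj_pointP[c _ ->].
by rewrite (meval_homogZ fh) fv mulr0.
Qed.

(** The default [0] arises only for empty [P], hence never for a projective point. *)
Definition coords P : 'rV[K]_n.+1 := odflt 0 [pick v in P].

Lemma coordsK P : P \in proj_space K n ->
  coords P != 0 /\ proj_point (coords P) = P.
Proof.
case/proj_spaceP=> v v0 ->; rewrite /coords.
case: pickP => [w /= wv|/(_ v)]; last by rewrite proj_point_refl.
split; last exact: mem_proj_point.
by case/proj_pointP: wv => c c0 ->; rewrite scaler_eq0 negb_or c0.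
Qed.

End AnyDimension.

(** The equation says that the determinant with rows [u] and [w] vanishes; the scaling factor is
    read off at a nonzero coordinate of [w]. *)
Lemma eq_proj_point2 (u w : 'rV[K]_2) : u != 0 -> w != 0 ->
  (proj_point u == proj_point w) = (u 0 0 * w 0 1 == u 0 1 * w 0 0).
Proof.
have eqP2 (x y : 'rV[K]_2) : x 0 0 = y 0 0 -> x 0 1 = y 0 1 -> x = y.
  move=> e0 e1; apply/rowP => i; case: (unliftP 0 i) => [j|] -> //.
  by rewrite [j]ord1 (_ : lift 0 0 = 1) //; apply/val_inj.
move=> u0 w0; rewrite eq_proj_point; apply/idP/eqP => [|e].
  by case/proj_pointP => c _ ->; rewrite !mxE mulrAC.
have key c : u = c *: w -> u \in proj_point w.
  by move=> uE; apply/proj_pointP; exists c => //; apply: contraNneq u0 => c0;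
    rewrite uE c0 scale0r.
have [w00|w00] := eqVneq (w 0 0) 0; last first.
  apply: (key (u 0 0 / w 0 0)); apply: eqP2; rewrite mxE ?divfK //.
  by rewrite mulrAC e mulfK.
have w01 : w 0 1 != 0.
  by apply: contraNneq w0 => w01; apply/eqP/eqP2; rewrite mxE.
apply: (key (u 0 1 / w 0 1)); apply: eqP2; rewrite mxE ?divfK //.
by rewrite mulrAC -e mulfK.
Qed.

(** * Lines of the projective plane and their intersections with curves *)

Section Plane.

Implicit Types (a v : 'rV[K]_3).

Lemma card_proj_line : #|proj_space K 1| = #|K|.+1.
Proof.
have := card_proj_space 1; have := card_finNzRing_gt1 K.
by case: #|K| => [|[|q]] // _; rewrite -mulnn; nia.
Qed.

Lemma card_proj_plane : #|proj_space K 2| = (#|K| ^ 2 + #|K| + 1)%N.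
Proof.
have := card_proj_space 2; have := card_finNzRing_gt1 K.
by case: #|K| => [|[|q]] // _; rewrite !expnS expn0; nia.
Qed.

Lemma mem_plane_line a v : v != 0 ->
  (proj_point v \in plane_line a) = (v *m a^T == 0).
Proof.
move=> v0; rewrite (@mem_rational_points _ 1) //; last first.
  by apply: rpred_sum => i _; rewrite rpredZ // dhomogX /= mdeg1.
have -> : v *m a^T = (\sum_(i < 3) a 0 i *: 'X_i).@[v 0]%:M.
  rewrite [LHS]mx11_scalar mxE; congr (_%:M); rewrite raddf_sum /=.
  by apply: eq_bigr => i _; rewrite mevalZ mevalXU mxE mulrC.
apply/eqP/eqP => [->|/rowP/(_ 0)]; first by rewrite raddf0.
by rewrite !mxE.
Qed.

Lemma card_plane_line a : a != 0 -> #|plane_line a| = #|K|.+1.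
Proof.
move=> a0; pose W := [set v : 'rV[K]_3 | v *m a^T == 0] :\ 0.
have WE : plane_line a = [set proj_point v | v in W].
  apply/setP=> P; apply/idP/imsetP => [Pa|[v]]; last first.
    by case/setD1P=> v0 + ->; rewrite mem_plane_line // inE.
  have /proj_spaceP[v v0 PE] : P \in proj_space K 2.
    by move: Pa; rewrite inE => /andP[].
  by exists v; rewrite // !inE v0 -mem_plane_line // -PE.
(* The cone over the line is the kernel of [a^T], of dimension 3 - 1 = 2, with the zero vector
   removed. *)
have cW : #|W| = (#|K| ^ 2).-1.
  have := card_rowg (kermx a^T); rewrite mxrank_ker mxrank_tr rank_rV a0 subn1 /=.
  have -> : rowg (kermx a^T) = [set v | v *m a^T == 0].
    by apply/setP=> v; rewrite mem_rowg inE; apply/sub_kermxP/eqP.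
  by rewrite (cardsD1 0) inE mul0mx eqxx => <-.
have := @card_proj_cone 2 W; rewrite -WE cW setD11 => /(_ isT) h.
have {}h : (#|plane_line a| * #|K|.-1 = (#|K| ^ 2).-1)%N.
  apply: h => c v c0; rewrite !inE scaler_eq0 negb_or c0 => /andP[-> /eqP va].
  by rewrite -scalemxAl va scaler0 eqxx.
move: h (card_finNzRing_gt1 K).
by case: #|K| => [|[|q]] //; rewrite -mulnn; nia.
Qed.

(** The kernel of [a^T] has rank 2, so one of the rows generating it lies outside the span of [v];
    that row serves as [w], and the rank forces [v] and [w] to span. *)
Lemma plane_line_span a v : a != 0 -> v != 0 -> v *m a^T = 0 ->
  exists w, forall x : 'rV[K]_3, x *m a^T = 0 -> exists b c, x = b *: v + c *: w.
Proof.
move=> a0 v0 va.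
have rk : \rank (kermx a^T) = 2 by rewrite mxrank_ker mxrank_tr rank_rV a0.
have /row_subPn[i wv] : ~~ (kermx a^T <= v)%MS.
  by apply/negP => /mxrankS; rewrite rk rank_rV v0.
set w := row i _ in wv; exists w => x /sub_kermxP xa.
suff /(submx_trans xa)/sub_addsmxP[[b c] /= ->] : (kermx a^T <= v + w)%MS.
  by exists (b 0 0), (c 0 0); rewrite [b]mx11_scalar [c]mx11_scalar
    !mul_scalar_mx !mxE !eqxx !mulr1n.
have sub : (v + w <= kermx a^T)%MS.
  by rewrite addsmx_sub row_sub andbT; apply/sub_kermxP.
rewrite -(mxrank_leqif_sup sub) eqn_leq mxrankS //= rk.
have := mxrank_leqif_sup (addsmxSl v w).
rewrite rank_rV v0 addsmx_sub submx_refl (negbTE wv) /= => -[le1 ne1].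
by rewrite ltn_neqAle ne1.
Qed.

(** Take a point [v] of the line off the curve and parametrize the other points as w + t v. The
    restriction of [f] has t^d-coefficient f(v), so it is a nonzero polynomial with at most [d]
    roots, and the omitted point [v] is not a zero. *)
Lemma card_line_zeros d (f : {mpoly K[3]}) a : f \is d.-homog -> a != 0 ->
  plane_line a \subset rational_points f \/
  (#|plane_line a :&: rational_points f| <= d)%N.
Proof.
move=> fh a0; have [|/subsetPn[P Pa nPf]] := boolP (_ \subset _); first by left.
right.
have inP Q : Q \in plane_line a -> Q \in proj_space K 2.
  by rewrite inE => /andP[].
have /proj_spaceP[v v0 PE] := inP _ Pa; subst P.
move: Pa nPf; rewrite mem_plane_line // (mem_rational_points fh) // => /eqP va fv.
have [w span] := plane_line_span a0 v0 va.
have [p [[sp lp] pE]] := homog_restrict_line fh v w.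
have p0 : p != 0 by apply: contraNneq fv => p0; rewrite -lp p0 coef0.
have sub : plane_line a :&: rational_points f \subset
    [set proj_point (w + t *: v) | t in [set t | root p t]].
  apply/subsetP=> Q /setIP[Qa Qf].
  have /proj_spaceP[x x0 QE] := inP _ Qa; subst Q.
  move: Qa Qf; rewrite mem_plane_line // (mem_rational_points fh) //.
  move=> /eqP xa /eqP fx; have [b [c xE]] := span _ xa.
  (* If c = 0 then x = b v, and 0 = f(x) = b^d f(v) forces b = 0, contradicting that [x] is
     nonzero. *)
  have c0 : c != 0.
    apply: contraNneq fv => c0; move: fx x0.
    rewrite xE c0 scale0r addr0 (meval_homogZ fh) scaler_eq0 negb_or => /eqP.
    by rewrite mulf_eq0 => /orP[|//]; rewrite expf_eq0 => /andP[_ ->].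
  have xE' : x = c *: (w + (b / c) *: v).
    by rewrite scalerDr scalerA mulrC divfK // xE addrC.
  apply/imsetP; exists (b / c); last by rewrite xE' proj_pointZ.
  move: fx; rewrite xE' (meval_homogZ fh) -pE inE => /eqP.
  by rewrite mulf_eq0 expf_eq0 (negbTE c0) andbF.
apply: leq_trans (subset_leq_card sub) _.
apply: leq_trans (leq_imset_card _ _) _.
rewrite -ltnS cardE; apply: leq_trans sp; apply: max_poly_roots => //.
  by apply/allP=> t; rewrite mem_enum inE.
exact: enum_uniq.
Qed.

End Plane.

End ProjectiveSpace.

(** * Colouring points by pencil members *)

Section Pencil.

Variables (K : finFieldType) (d : nat) (F G : {mpoly K[3]}).
Hypotheses (d_gt0 : (0 < d)%N) (F_homog : F \is d.-homog)
  (G_homog : G \is d.-homog)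
  (no_base_points : rational_points F :&: rational_points G = set0).

(* Off the base locus, [s : t] = [G(P) : - F(P)] is the only parameter with
   s F(P) + t G(P) = 0. *)
Definition pencil_coords (v : 'rV[K]_3) : 'rV[K]_2 :=
  \row_(i < 2) if i == 0 then G.@[v 0] else - F.@[v 0].

Definition pencil_param (P : {set 'rV[K]_3}) : {set 'rV[K]_2} :=
  proj_point (pencil_coords (coords P)).

(** A zero vector here would make [v] a rational base point; this is what gives every point a
    colour. *)
Lemma pencil_coords_neq0 v : v != 0 -> pencil_coords v != 0.
Proof.
move=> v0; apply/eqP => /rowP w0.
have Gv : G.@[v 0] = 0 by have := w0 0; rewrite !mxE.
have Fv : F.@[v 0] = 0.
  by have := w0 1; rewrite !mxE /= => /eqP; rewrite oppr_eq0 => /eqP.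
suff : proj_point v \in set0 by rewrite inE.
rewrite -no_base_points in_setI (mem_rational_points F_homog) //.
by rewrite (mem_rational_points G_homog) // Fv Gv eqxx.
Qed.

Lemma pencil_param_in P : P \in proj_space K 2 ->
  pencil_param P \in proj_space K 1.
Proof.
move=> /coordsK[v0 _]; apply/proj_spaceP.
by exists (pencil_coords (coords P)); rewrite ?pencil_coords_neq0.
Qed.

Lemma pencil_member_homog u : pencil_member F G u \is d.-homog.
Proof. by rewrite rpredD // rpredZ. Qed.

Lemma mem_pencil_member u P : u != 0 -> P \in proj_space K 2 ->
  (P \in rational_points (pencil_member F G u)) =
  (pencil_param P == proj_point u).
Proof.
move=> u0 /coordsK[v0 PE].
rewrite -{1}PE (mem_rational_points (pencil_member_homog u)) //.
(* For u = (s, t) the determinant criterion reads - s F(v) = t G(v), the equation of the member at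
   [v]. *)
rewrite [RHS]eq_sym eq_proj_point2 ?pencil_coords_neq0 // !mxE /=.
by rewrite mevalD !mevalZ mulrN eqr_oppLR addr_eq0.
Qed.

Lemma color_class_plane_line a u : u != 0 ->
  color_class pencil_param (plane_line a) (proj_point u) =
  plane_line a :&: rational_points (pencil_member F G u).
Proof.
move=> u0; apply/setP=> P; rewrite in_setI in_set.
have [Pa|//] := boolP (P \in plane_line a).
by rewrite mem_pencil_member //; move: Pa; rewrite inE => /andP[].
Qed.

(** The line [a] itself witnesses nonblocking: its intersection with the member is the empty colour
    class. *)
Lemma missed_param_nonblocking a : a != 0 ->
  [set m in proj_space K 1 | color_class pencil_param (plane_line a) m == set0]
    \subset nonblocking_members F G.
Proof.
move=> a0; apply/subsetP=> m; rewrite !in_set => /andP[mP /eqP miss].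
rewrite mP /=; apply/forall_inP => u um.
have /proj_spaceP[w w0 mE] := mP.
have uE : proj_point u = m by rewrite mE; apply: mem_proj_point; rewrite -mE.
have u0 : u != 0.
  move: um; rewrite mE => /proj_pointP[c c0 ->].
  by rewrite scaler_eq0 negb_or c0.
apply/forall_inPn; exists a => //.
by rewrite negbK -color_class_plane_line // uE miss.
Qed.

Lemma exists_line_many_same_param : exists2 a : 'rV[K]_3, a != 0 &
  (#|K| <= #|mono_pairs pencil_param (plane_line a)|)%N.
Proof.
(* By duality the lines are indexed by points [A] of the plane, [coords A] being the coefficient
   vector. *)
have [//||A AL h] := @exists_line_many_mono_pairs _ _ _ pencil_param
  (proj_space K 1) (proj_space K 2) (proj_space K 2)
  (fun A => plane_line (coords A)) #|K| (ltnW (card_finNzRing_gt1 K))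
  (card_proj_line K) (card_proj_plane K) (card_proj_plane K).
- exact: pencil_param_in.
- move=> P Q /coordsK[v0 PE] /coordsK[w0 QE] _.
  set v := coords P in v0 PE; set w := coords Q in w0 QE.
  (* A matrix with 3 rows and 2 columns has a nonzero left kernel vector, whose line joins the two
     points. *)
  have /rowV0Pn[a] : kermx (row_mx v^T w^T) != 0.
    by rewrite -mxrank_eq0 mxrank_ker -lt0n subn_gt0 ltnS rank_leq_col.
  move=> /sub_kermxP; rewrite mul_mx_row -row_mx0 => /eq_row_mx[av aw] a0.
  exists (proj_point a); first by apply/proj_spaceP; exists a.
  have /coordsK[_ aE] : proj_point a \in proj_space K 2.
    by apply/proj_spaceP; exists a.
  have /proj_pointP[c _ ->] : coords (proj_point a) \in proj_point a.
    by rewrite -eq_proj_point aE.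
  (* The chosen coordinates of [proj_point a] are only a multiple of [a], which preserves
     orthogonality. *)
  have orth x : a *m x^T = 0 -> x *m (c *: a)^T = 0.
    by move=> ax; rewrite -[LHS]trmxK trmx_mul trmxK -scalemxAl ax scaler0 trmx0.
  by rewrite -PE -QE !mem_plane_line // !orth // eqxx.
by exists (coords A) => //; case: (coordsK AL).
Qed.

Lemma nonblocking_members_mul : (#|K| <= d * #|nonblocking_members F G|)%N.
Proof.
have [a a0 many] := exists_line_many_same_param.
have paramL : {in plane_line a, forall P, pencil_param P \in proj_space K 1}.
  by move=> P; rewrite inE => /andP[/pencil_param_in].
have := subset_leq_card (missed_param_nonblocking a0).
rewrite (card_missed_colors paramL) ?card_plane_line ?card_proj_line //.
rewrite -(leq_pmul2l d_gt0); apply: leq_trans.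
have [/exists_inP[c cC]|/exists_inPn small] :=
    boolP [exists c in proj_space K 1,
      (d < #|color_class pencil_param (plane_line a) c|)%N].
  (* More than [d] points force the member to contain the line, so the term of [c] alone contributes
     d q. *)
  move=> big; rewrite (bigD1 c) //= mulnDr.
  have -> : #|color_class pencil_param (plane_line a) c| = #|K|.+1.
    have /proj_spaceP[u u0 cE] := cC; move: big.
    rewrite cE color_class_plane_line // ltnNge.
    have [/setIidPl-> _|-> //] := card_line_zeros (pencil_member_homog u) a0.
    exact: card_plane_line.
  by rewrite /= (leq_trans (leq_pmull _ d_gt0)) // leq_addr.
(* All classes have size x <= d, so x (x - 1) <= d (x - 1) term by term. *)
apply: leq_trans many _; rewrite (card_mono_pairs paramL) big_distrr /=.
by apply: leq_sum => c cC; rewrite leq_mul2r leqNgt small ?orbT.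
Qed.

End Pencil.

Theorem theorem1p5 (K : finFieldType) (d : nat) (F G : {mpoly K[3]})
    (d_gt0 : (0 < d)%N)
    (d_le_q : (d <= #|K|)%N)
    (F_homog : F \is d.-homog)
    (G_homog : G \is d.-homog)
    (FG_indep : lin_indep F G)
    (no_base_points : rational_points F :&: rational_points G = set0) :
  (#|K| + 1)%:R / (d + 1)%:R <= #|nonblocking_members F G|%:R :> rat.
Proof.
have := nonblocking_members_mul d_gt0 F_homog G_homog no_base_points.
have := card_finNzRing_gt1 K.
rewrite ler_pdivrMr ?ltr0n ?addn1 // -natrM ler_nat.
(* With N the number of nonblocking members, q <= d N and q > 1 exclude N = 0; adding 1 <= N gives q
   + 1 <= (d + 1) N. *)
by case: #|nonblocking_members F G|%N => [|N]; nia.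
Qed.
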